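(* Let $\mathcal{K}$ be the class of $\{\to\}$-subreducts of subresiduated lattices (viewed as algebras $(A,\to,1)$ of type $(2,0)$). Then every sub-Hilbert algebra belongs to $\mathcal{K}$.
   Context: A subresiduated lattice is an algebra $(A,\wedge,\vee,\to,0,1)$ of type $(2,2,2,0,0)$ such that $(A,\wedge,\vee,0,1)$ is a bounded distributive lattice and for all $x,y,z\in A$: $x\to x=1$; $x\to y\le z\to(x\to y)$; $x\wedge(x\to y)\le y$; $z\to(x\wedge y)=(z\to x)\wedge(z\to y)$; $(x\vee y)\to z=(x\to z)\wedge(y\to z)$; $(x\to y)\wedge(y\to z)\le x\to z$. A $\{\to\}$-subreduct of a subresiduated lattice $A$ is any isomorphic image of a (nonempty) subalgebra of the reduct $(A,\to)$. Since $1=x\to x$, such a subalgebra always contains $1$, so it is viewed as an algebra of type $(2,0)$ with operations $\to,1$. A sub-Hilbert algebra is an algebra $(A,\to,1)$ of type $(2,0)$ satisfying, for all $x,y,z\in A$: (B) $(x\to y)\to((y\to z)\to(x\to z))=1$; (I) $x\to x=1$; (T) $x\to 1=1$; (A) if $x\to y=1$ and $y\to x=1$ then $x=y$; (S) $(x\to(y\to z))\to((x\to y)\to(x\to z))=1$. *)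

(* Defs.v *)
From mathcomp Require Import all_boot all_order.
From mathcomp Require Import boolp classical_sets.

Set Implicit Arguments.
Unset Strict Implicit.
Unset Printing Implicit Defensive.

Local Open Scope classical_set_scope.
Local Open Scope order_scope.

(* Algebras (A, ->, 1) of type (2, 0). *)
Record algebra20 := Algebra20 {
  carrier :> Type;
  imp : carrier -> carrier -> carrier;
  one : carrier
}.
Arguments one {a}.

Record sub_Hilbert (A : algebra20) : Prop := SubHilbert {
  sub_Hilbert_B : forall x y z : A,
    imp (imp x y) (imp (imp y z) (imp x z)) = one;
  sub_Hilbert_I : forall x : A, imp x x = one;
  sub_Hilbert_T : forall x : A, imp x one = one;
  sub_Hilbert_A : forall x y : A, imp x y = one -> imp y x = one -> x = y;
  sub_Hilbert_S : forall x y z : A,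
    imp (imp x (imp y z)) (imp (imp x y) (imp x z)) = one
}.

(* A tbDistrLatticeType may be trivial: \bot = \top is not excluded. *)
Record subresiduated d (L : tbDistrLatticeType d) (r : L -> L -> L) : Prop :=
  Subresiduated {
    subres_refl : forall x, r x x = \top;
    subres_stable : forall x y z, r x y <= r z (r x y);
    subres_mp : forall x y, x `&` r x y <= y;
    subres_meet : forall x y z, r z (x `&` y) = r z x `&` r z y;
    subres_join : forall x y z, r (x `|` y) z = r x z `&` r y z;
    subres_trans : forall x y z, r x y `&` r y z <= r x z
  }.

(* Nonempty subalgebras of the {->}-reduct. *)
Record imp_subuniverse (T : Type) (r : T -> T -> T) (S : set T) : Prop :=
  ImpSubuniverse {
    imp_subuniverse_nonempty : S !=set0;
    imp_subuniverse_closed : forall x y, x \in S -> y \in S -> r x y \in S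
  }.

Lemma imp_subuniverse_top d (L : tbDistrLatticeType d) (r : L -> L -> L)
    (S : set L) :
  subresiduated r -> imp_subuniverse r S -> \top \in S.
Proof.
move=> rL [[x /mem_set Sx] closedS].
by rewrite -(subres_refl rL x); apply: closedS.
Qed.

Definition imp_subalgebra d (L : tbDistrLatticeType d) (r : L -> L -> L)
    (rL : subresiduated r) (S : set L) (hS : imp_subuniverse r S) :
    algebra20 :=
  @Algebra20 {x : L | x \in S}
    (fun x y => exist _ (r (sval x) (sval y))
                        (imp_subuniverse_closed hS (svalP x) (svalP y)))
    (exist _ \top (imp_subuniverse_top rL hS)).

Definition isomorphic (B C : algebra20) : Prop :=
  exists f : B -> C,
    [/\ bijective f,
        forall x y, f (imp x y) = imp (f x) (f y) &
        f one = one].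

(* The class K of {->}-subreducts of subresiduated lattices. *)
Definition imp_subreduct_of_srl (A : algebra20) : Prop :=
  exists (d : Order.disp_t) (L : tbDistrLatticeType d) (r : L -> L -> L)
         (rL : subresiduated r) (S : set L) (hS : imp_subuniverse r S),
    isomorphic (imp_subalgebra rL hS) A.

(* Main.v *)
(** Kripke semantics for strict implication. The subsets of a preordered set
    form a subresiduated lattice under the strict implication
    [X -> Y = {w | every v above w that lies in X lies in Y}]. A sub-Hilbert
    algebra embeds into the one built on its implicative filters, where [G] is
    above [F] when every implication of [F] is respected by [G], by sending [a]
    to the set of filters containing [a]. *)
From mathcomp Require Import all_boot all_order.
From mathcomp Require Import boolp classical_sets.
Require Import Defs.

Set Implicit Arguments.
Unset Strict Implicit.
Unset Printing Implicit Defensive.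

Local Open Scope classical_set_scope.

Definition strict_imp (W : Type) (R : W -> W -> Prop) (X Y : set W) : set W :=
  [set w | forall v, R w v -> X v -> Y v].

(** Reflexivity gives modus ponens [subres_mp], transitivity gives [subres_stable]; the other laws
    are checked pointwise at the worlds above [w]. *)
Lemma strict_imp_subresiduated (W : Type) (R : W -> W -> Prop) :
  (forall w, R w w) -> (forall u v w, R u v -> R v w -> R u w) ->
  subresiduated (strict_imp R).
Proof.
move=> Rrefl Rtrans; split.
- by move=> X; apply/seteqP; split=> // w _ v.
- move=> X Y Z; rewrite subsetEset => w XYw v Rwv _ u Rvu.
  by apply: XYw; apply: Rtrans Rvu.
- by move=> X Y; rewrite subsetEset => w [Xw XYw]; apply: XYw (Rrefl w) Xw.
- move=> X Y Z; apply/seteqP; split=> w.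
  + by move=> ZXYw; split=> v Rwv Zv; case: (ZXYw v Rwv Zv).
  + by move=> [ZXw ZYw] v Rwv Zv; split; [apply: ZXw | apply: ZYw].
- move=> X Y Z; apply/seteqP; split=> w.
  + by move=> XYZw; split=> v Rwv Hv; apply: XYZw => //; [left | right].
  + by move=> [XZw YZw] v Rwv [Xv|Yv]; [apply: XZw | apply: YZw].
- move=> X Y Z; rewrite subsetEset => w [XYw YZw] v Rwv Xv.
  by apply: YZw => //; apply: XYw.
Qed.

Record imp_filter (A : algebra20) (F : set A) : Prop := ImpFilter {
  imp_filter_one : F one;
  imp_filter_mp : forall a b, F a -> F (imp a b) -> F b
}.

Section CanonicalFrame.

Variables (A : algebra20) (hA : sub_Hilbert A).

Lemma sub_Hilbert_mp (a b : A) : a = one -> imp a b = one -> b = one.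
Proof. by move=> -> ?; apply: (sub_Hilbert_A hA) => //; apply: sub_Hilbert_T. Qed.

Lemma imp_filter_theorem (F : set A) (a b : A) :
  imp_filter F -> imp a b = one -> F a -> F b.
Proof.
move=> hF ab Fa; apply: (imp_filter_mp hF Fa).
by rewrite ab; apply: imp_filter_one.
Qed.

(* (B) with the middle and last arguments equal, where [y -> y] is [1]. *)
Lemma sub_Hilbert_box (a b : A) : imp (imp a b) (imp one (imp a b)) = one.
Proof. by rewrite -{1}(sub_Hilbert_I hA b); apply: sub_Hilbert_B. Qed.

(** (T) and (S) relativize the unit and modus ponens to the hypothesis [a]. These filters contain
    [a] by (I) and serve as the witnesses below. *)
Lemma imp_filter_imp (F : set A) (a : A) :
  imp_filter F -> imp_filter [set b | F (imp a b)].
Proof.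
move=> hF; split=> [|b c /= Fab Fabc].
  by rewrite /= (sub_Hilbert_T hA); apply: imp_filter_one.
apply: (imp_filter_mp hF Fab).
exact: imp_filter_theorem hF (sub_Hilbert_S hA a b c) Fabc.
Qed.

Lemma imp_filter_ones : imp_filter [set one : A].
Proof. by split=> // a b; apply: sub_Hilbert_mp. Qed.

Definition filters := {F : set A | imp_filter F}.

Definition above (F G : filters) : Prop :=
  forall a b, sval F (imp a b) -> sval G a -> sval G b.

Lemma above_refl (F : filters) : above F F.
Proof. by move=> a b Fab Fa; apply: (imp_filter_mp (svalP F)) Fa Fab. Qed.

(** [F] also contains [imp one (imp a b)], and [G] contains [one]. This persistence of implications
    makes [above] transitive. *)
Lemma above_imp (F G : filters) (a b : A) :
  above F G -> sval F (imp a b) -> sval G (imp a b).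
Proof.
move=> FG Fab; apply: FG (imp_filter_one (svalP G)).
exact: imp_filter_theorem (svalP F) (sub_Hilbert_box a b) Fab.
Qed.

Lemma above_trans (F G H : filters) : above F G -> above G H -> above F H.
Proof. by move=> FG GH a b Fab; apply/GH/(above_imp FG). Qed.

Definition filters_of (a : A) : set filters := [set F | sval F a].

Lemma filters_of_imp (a b : A) :
  filters_of (imp a b) = strict_imp above (filters_of a) (filters_of b).
Proof.
apply/seteqP; split=> [F Fab G FG Ga | [F hF] /= sab]; first exact: FG Fab Ga.
(* Test [sab] at the filter of all [c] with [imp a c] in [F]: it is above [F] by (B) and contains
   [a] by (I). *)
apply: (sab (exist _ _ (imp_filter_imp a hF))) => [c d /= Fcd Fac | /=].
  apply: (imp_filter_mp hF Fcd).
  exact: imp_filter_theorem hF (sub_Hilbert_B hA a c d) Fac.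
by rewrite /filters_of /= (sub_Hilbert_I hA); apply: imp_filter_one.
Qed.

(** The filter of all [c] with [imp a c = one] contains [a], hence [b]. *)
Lemma filters_of_sub (a b : A) :
  filters_of a `<=` filters_of b -> imp a b = one.
Proof.
move=> /(_ (exist _ _ (imp_filter_imp a imp_filter_ones))); apply.
exact: sub_Hilbert_I.
Qed.

Lemma filters_of_inj : injective filters_of.
Proof.
by move=> a b eq_ab; apply: (sub_Hilbert_A hA); apply: filters_of_sub;
  rewrite eq_ab.
Qed.

Lemma filters_of_one : filters_of one = setT.
Proof.
by apply/seteqP; split=> // F _; apply: imp_filter_one (svalP F).
Qed.

Lemma range_filters_of_subuniverse :
  imp_subuniverse (strict_imp above) (range filters_of).
Proof.
split=> [|X Y /set_mem[a _ <-] /set_mem[b _ <-]].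
  by exists (filters_of one), one.
by rewrite -filters_of_imp; apply/mem_set; exists (imp a b).
Qed.

End CanonicalFrame.

Theorem proposition3p24 (A : algebra20) (hA : sub_Hilbert A) :
  imp_subreduct_of_srl A.
Proof.
exists _, (set (filters A)), (@strict_imp (filters A) (@above A)).
exists (strict_imp_subresiduated (@above_refl A) (above_trans hA)).
exists (range (@filters_of A)), (range_filters_of_subuniverse hA).
(* The isomorphism must go from the range to [A], so it is a chosen inverse of [filters_of];
   injectivity makes the choice unique. *)
have preim (X : {X | X \in range (@filters_of A)}) :
    {a | filters_of a = sval X}.
  by apply: cid; have /set_mem[a _ aX] := svalP X; exists a.
pose f X := sval (preim X).
have fK X : filters_of (f X) = sval X := svalP (preim X).
have range_mem a : filters_of a \in range (@filters_of A).
  by apply/mem_set; exists a.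
pose g a : {X | X \in range (@filters_of A)} :=
  Sub (filters_of a) (range_mem a).
exists f; split.
- apply: (@Bijective _ _ f g) => [X|a].
    by apply: (@val_inj _ _ {X | X \in range (@filters_of A)}); apply: fK.
  by apply: (filters_of_inj hA); rewrite fK.
(* Equations in [A] are verified on their images under the injective [filters_of]. *)
- by move=> X Y; apply: (filters_of_inj hA); rewrite filters_of_imp// !fK.
- by apply: (filters_of_inj hA); rewrite filters_of_one fK.
Qed.
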